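(* Let $(M,g)$ be a smooth connected compact Riemannian manifold (with smooth boundary if $\partial M\neq\emptyset$). If $(M,g)$ satisfies the dichotomy property, then all its geodesics satisfy (GRC), i.e. every generalized geodesic of $M$ satisfies (GRC) for every $\varepsilon>0$.
   Context: Geodesics are generalized geodesics traveled at speed $1$: the projections onto $M$, parametrized by time $t\in\mathbb{R}$, of the generalized bicharacteristics of Melrose and Sjöstrand. They are usual unit-speed geodesics in the interior of $M$ and reflect on $\partial M$ (if non-empty) according to the laws of geometric optics. Dichotomy property: $(M,g)$ satisfies the dichotomy property if each of its geodesics $t\mapsto y(t)$ is either periodic or uniformly distributed, the latter meaning that for every open set $U\subset M$, $$\lim_{T\to+\infty}\frac{|\{t\in[0,T]\mid y(t)\in U\}|}{T}=\frac{\mathrm{vol}_g(U)}{\mathrm{vol}_g(M)}.$$ (GRC) for $\varepsilon>0$: a generalized geodesic $t\mapsto y(t)$ satisfies (GRC) for $\varepsilon$ if there exists an open ball $U\subset M$ (depending on $y(\cdot)$) of radius $<\varepsilon$ such that $$\liminf_{T\to+\infty}\frac{|\{t\in[0,T]\mid y(t)\in U\}|}{T}>0.$$ Here $|A|$ is the Lebesgue measure of a measurable set $A\subset\mathbb{R}$. *)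

(* Defs.v *)
From HB Require Import structures.
From mathcomp Require Import all_boot all_order all_algebra.
From mathcomp Require Import all_classical all_reals all_analysis.

Set Implicit Arguments.
Unset Strict Implicit.
Unset Printing Implicit Defensive.

Import Order.TTheory GRing.Theory Num.Theory.
Import numFieldNormedType.Exports.

Local Open Scope classical_set_scope.
Local Open Scope ring_scope.

Section calculus.
Variable R : realType.

(* One-sided derivative at [a] in the direction [v].  On the half-space
   [0 <= x_0] every coordinate direction e_i satisfies a + h e_i in the
   half-space for h > 0, so this computes the partial derivatives of a smooth
   function up to and including the boundary. *)
Definition rderive (V : normedModType R) (f : V -> R) (v a : V) : R :=
  lim ((h^-1 * (f (a + h *: v) - f a)) @[h --> (0 : R)^'+]).

(* Row convention, as in the library's ['J]: entry (i, j) is d f_j / d x_i. *)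
Definition rjacobian n (f : 'rV[R]_n -> 'rV[R]_n) (a : 'rV[R]_n) : 'M[R]_n :=
  \matrix_(i, j) rderive (fun v => f v 0 j) (delta_mx 0 i) a.

Definition Cinfty n (O : set 'rV[R]_n) (F : 'rV[R]_n -> R) : Prop :=
  forall (s : seq 'I_n) x, O x ->
    differentiable
      (foldr (fun i (h : 'rV[R]_n -> R) => 'D_(delta_mx 0 i) h) F s) x.

(* Smoothness on an arbitrary subset of R^n: local smooth extendability. *)
Definition smooth_on n (S : set 'rV[R]_n) (f : 'rV[R]_n -> R) : Prop :=
  forall a, S a -> exists (O : set 'rV[R]_n) (F : 'rV[R]_n -> R),
    [/\ open O, O a, Cinfty O F & forall x, O x -> S x -> F x = f x].

(* The Lebesgue integral over R^n of a nonnegative Borel function, as an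
   iterated integral (Tonelli). *)
Fixpoint lebint n : ('rV[R]_n -> \bar R) -> \bar R :=
  match n with
  | 0 => fun f => f 0
  | n'.+1 => fun f => (\int[lebesgue_measure]_(x in [set: R])
      lebint (fun v : 'rV[R]_n' => f (row_mx (x%:M : 'M[R]_1) v)))%E
  end.

Definition halfspace n : set 'rV[R]_n.+1 := [set v | 0 <= v 0 ord0].

End calculus.

(* [M] has dimension [n.+1]; the values of [cmap] off [cdom] and of [cinv] off
   the image of [cdom] are irrelevant. *)
Record chart (R : realType) (M : ptopologicalType) (n : nat) := Chart {
  cdom : set M ;
  cmap : M -> 'rV[R]_n.+1 ;
  cinv : 'rV[R]_n.+1 -> M ;
  cdom_open : open cdom ;
  cmap_open : exists2 V : set 'rV[R]_n.+1,
    open V & cmap @` cdom = V `&` @halfspace R n ;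
  cmapK : forall x, cdom x -> cinv (cmap x) = x ;
  cmap_continuous : {within cdom, continuous cmap} ;
  cinv_continuous : {within cmap @` cdom, continuous cinv}
}.

Section chart_ops.
Context {R : realType} {M : ptopologicalType} {n : nat}.
Implicit Types c : chart R M n.

Definition cimg c : set 'rV[R]_n.+1 := cmap c @` cdom c.

Definition transition c c' : 'rV[R]_n.+1 -> 'rV[R]_n.+1 :=
  fun v => cmap c' (cinv c v).

Definition trans_jac c c' (x : M) : 'M[R]_n.+1 :=
  rjacobian (transition c c') (cmap c x).

End chart_ops.

Record smooth_manifold (R : realType) (M : ptopologicalType) (n : nat) :=
  SmoothManifold {
  atlas : set (chart R M n) ;
  manifold_hausdorff : hausdorff_space M ;
  manifold_second_countable : @second_countable M ;
  atlas_cover : forall x : M, exists2 c, atlas c & cdom c x ;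
  atlas_smooth : forall c c' j, atlas c -> atlas c' ->
    smooth_on (cmap c @` (cdom c `&` cdom c')) (fun v => transition c c' v 0 j)
}.

Section manifold_ops.
Context {R : realType} {M : ptopologicalType} {n : nat}.
Variable A : smooth_manifold R M n.

Definition chart_around (x : M) : set (chart R M n) :=
  [set c | atlas A c /\ cdom c x].

Definition bdry : set M :=
  [set x | exists2 c, chart_around x c & cmap c x 0 ord0 = 0].

End manifold_ops.

Record riem_metric (R : realType) (M : ptopologicalType) (n : nat)
    (A : smooth_manifold R M n) := RiemMetric {
  gmx : chart R M n -> 'rV[R]_n.+1 -> 'M[R]_n.+1 ;
  gmx_smooth : forall c i j, atlas A c ->
    smooth_on (cimg c) (fun v => gmx c v i j) ;
  gmx_sym : forall c v, atlas A c -> cimg c v -> (gmx c v)^T = gmx c v ;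
  gmx_posdef : forall c v, atlas A c -> cimg c v ->
    forall w : 'rV[R]_n.+1, w != 0 -> 0 < (w *m gmx c v *m w^T) 0 0 ;
  gmx_compat : forall c c' x, chart_around A x c -> chart_around A x c' ->
    gmx c (cmap c x) =
    trans_jac c c' x *m gmx c' (cmap c' x) *m (trans_jac c c' x)^T
}.

Section riemannian.
Context {R : realType} {M : ptopologicalType} {n : nat}.
Context {A : smooth_manifold R M n}.
Variable g : riem_metric A.

(* [curve_length x z l]: some piecewise C^1 curve from x to z has length l.  A
   curve is subdivided into C^1 arcs, each contained in the domain of one
   chart; [f] is the coordinate expression of an arc, extended to a C^1
   function on the whole line. *)
Inductive curve_length : M -> M -> \bar R -> Prop :=
| length_arc (c : chart R M n) (a b : R) (f : R -> 'rV[R]_n.+1) :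
    atlas A c -> a <= b ->
    (forall s, derivable f s 1) -> continuous (derive1 f) ->
    (forall s, a <= s <= b -> cimg c (f s)) ->
    curve_length (cinv c (f a)) (cinv c (f b))
      (\int[lebesgue_measure]_(s in `[a, b])
        (Num.sqrt ((derive1 f s *m gmx g c (f s) *m (derive1 f s)^T) 0 0))%:E)%E
| length_cat x y z l l' :
    curve_length x y l -> curve_length y z l' -> curve_length x z (l + l')%E.

Definition riem_dist (x z : M) : \bar R := ereal_inf (curve_length x z).

Definition riem_ball (x : M) (r : R) : set M :=
  [set z | (riem_dist x z < r%:E)%E].

(* vol_g is the unique Borel measure with density sqrt(det g) in each chart. *)
Definition is_riem_volume
    (vol : set (g_sigma_algebraType (@open M)) -> \bar R) : Prop :=
  forall c (S : set (g_sigma_algebraType (@open M))),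
    atlas A c -> measurable S -> S `<=` cdom c ->
    vol S = lebint (fun v =>
      ((\1_(cmap c @` S) v : R) * Num.sqrt (\det (gmx g c v)))%:E).

End riemannian.

Section hamilton.
Context {R : realType} {k : nat}.

(* Points (z, zeta) of the cotangent bundle of R^k. *)
Local Notation phase := ('rV[R]_k * 'rV[R]_k)%type.
Implicit Types (p q phi : phase -> R) (w : phase).

Definition pd_base p (i : 'I_k) w : R := rderive p (delta_mx 0 i, 0) w.
Definition pd_fiber p (i : 'I_k) w : R := rderive p (0, delta_mx 0 i) w.

(* {p, q} = H_p q *)
Definition poisson p q w : R :=
  \sum_(i < k) (pd_fiber p i w * pd_base q i w - pd_base p i w * pd_fiber q i w).

Definition ham_field p w : phase :=
  (\row_i pd_fiber p i w, - \row_i pd_base p i w).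

(* The following three notions are those of Melrose and Sjöstrand (in the
   notation of Hörmander, The Analysis of Linear Partial Differential Operators
   III, Section 24.3) for a manifold given locally by [0 <= phi], with boundary
   [phi = 0]. *)

Definition glancing p phi w : Prop :=
  [/\ p w = 0, phi w = 0 & poisson p phi w = 0].

Definition diffractive p phi w : Prop :=
  glancing p phi w /\ 0 < poisson p (poisson p phi) w.

Definition gliding_field p phi w : phase :=
  ham_field p w +
  (poisson p (poisson p phi) w / poisson phi (poisson phi p) w)
    *: ham_field phi w.

End hamilton.

(* Derivative at [s] of a function defined on the complement of [B]. *)
Definition has_deriv_off {R : realType} (V : normedModType R) (B : set R)
    (f : R -> V) (s : R) (v : V) : Prop :=
  (h^-1 *: (f (s + h) - f s))
    @[h --> within (fun h => ~ B (s + h)) ((0 : R)^')] --> v.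

Section geodesics.
Context {R : realType} {M : ptopologicalType} {n : nat}.
Context {A : smooth_manifold R M n}.
Variable g : riem_metric A.

(* In a chart of M, a point (t, x, tau, xi) of T^*(R x M) is written
   ((x, t), (xi, tau)): the time variable comes last, so that coordinate 0
   still defines the boundary. *)
Local Notation phase := ('rV[R]_(n.+1 + 1) * 'rV[R]_(n.+1 + 1))%type.

(* Principal symbol |xi|_g^2 - tau^2 of the wave operator. *)
Definition wave_symbol (c : chart R M n) (w : phase) : R :=
  let x := lsubmx w.1 in
  let xi := lsubmx w.2 in
  let tau := rsubmx w.2 0 0 in
  (xi *m invmx (gmx g c x) *m xi^T) 0 0 - tau ^+ 2.

Definition bdry_fun (w : phase) : R := w.1 0 (lshift 1 ord0).

Definition coords (t tau : R -> R) (x : R -> M)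
    (xi : R -> chart R M n -> 'rV[R]_n.+1) (c : chart R M n) (s : R) : phase :=
  (row_mx (cmap c (x s)) (t s)%:M, row_mx (xi s c) (tau s)%:M).

(* Generalized bicharacteristics s |-> (t, x, tau, xi), defined for every real
   s outside the set [B] of hyperbolic reflections.  The covector of M carried
   by the curve at [s] is given by its components [xi s c] in each chart [c].
   A reflection only changes the component of xi transverse to the boundary:
   t, tau and x keep a value on [B], the common value of their two one-sided
   limits, whereas [xi] is meaningless on [B]. *)
Record gen_bicharacteristic (B : set R) (t tau : R -> R) (x : R -> M)
    (xi : R -> chart R M n -> 'rV[R]_n.+1) : Prop := GenBicharacteristic {
  gb_t_continuous : continuous t ;
  gb_tau_continuous : continuous tau ;
  gb_x_continuous : continuous x ;
  gb_covector : forall s c c', ~ B s ->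
    chart_around A (x s) c -> chart_around A (x s) c' ->
    xi s c = xi s c' *m (trans_jac c c' (x s))^T ;
  gb_nonzero : forall s c, ~ B s -> chart_around A (x s) c ->
    (coords t tau x xi c s).2 != 0 ;
  gb_characteristic : forall s c, ~ B s -> chart_around A (x s) c ->
    wave_symbol c (coords t tau x xi c s) = 0 ;
  (* outside B the curve lies over the interior or in the glancing set *)
  gb_glancing : forall s c, ~ B s -> chart_around A (x s) c ->
    bdry A (x s) -> glancing (wave_symbol c) bdry_fun (coords t tau x xi c s) ;
  gb_free : forall s c, ~ B s -> chart_around A (x s) c ->
    ~ bdry A (x s) \/
    diffractive (wave_symbol c) bdry_fun (coords t tau x xi c s) ->
    has_deriv_off B (coords t tau x xi c) s
      (ham_field (wave_symbol c) (coords t tau x xi c s)) ;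
  gb_gliding : forall s c, ~ B s -> chart_around A (x s) c ->
    bdry A (x s) ->
    ~ diffractive (wave_symbol c) bdry_fun (coords t tau x xi c s) ->
    has_deriv_off B (coords t tau x xi c) s
      (gliding_field (wave_symbol c) bdry_fun (coords t tau x xi c s)) ;
  gb_reflect_bdry : forall b, B b -> bdry A (x b) ;
  gb_reflect_isolated : forall b, B b ->
    \forall s \near b^', ~ B s /\ ~ bdry A (x s) ;
  gb_reflect : forall b c, B b -> chart_around A (x b) c ->
    exists xim xip : 'rV[R]_n.+1,
      [/\ xi s c @[s --> b^'-] --> xim,
          xi s c @[s --> b^'+] --> xip,
          xim != xip
        & forall i, i != ord0 -> xim 0 i = xip 0 i]
}.

(* Along a generalized bicharacteristic dt/ds = - 2 tau is a nonzero constant,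
   so s |-> t s is a bijection of R and the equation determines [y]. *)
Definition geodesic (y : R -> M) : Prop :=
  exists B t tau x xi,
    gen_bicharacteristic B t tau x xi /\ forall s, y (t s) = x s.

Definition periodic (y : R -> M) : Prop :=
  exists2 P : R, 0 < P & forall t, y (t + P) = y t.

Definition time_fraction (y : R -> M) (U : set M) (T : R) : R :=
  fine (lebesgue_measure [set t : R | 0 <= t <= T /\ U (y t)]) / T.

Definition unif_distributed
    (vol : set (g_sigma_algebraType (@open M)) -> \bar R) (y : R -> M) : Prop :=
  forall U : set M, open U ->
    time_fraction y U T @[T --> +oo] --> fine (vol U) / fine (vol [set: M]).

Definition dichotomy
    (vol : set (g_sigma_algebraType (@open M)) -> \bar R) : Prop :=
  forall y, geodesic y -> periodic y \/ unif_distributed vol y.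

Definition GRC (eps : R) (y : R -> M) : Prop :=
  exists (x : M) (r : R), [/\ 0 < r, r < eps &
    (0 < limf_einf (fun T => (time_fraction y (riem_ball g x r) T)%:E)
                   (pinfty_nbhs R))%E].

End geodesics.

(* Main.v *)
Require Import Defs.
From mathcomp Require Import all_boot all_order all_algebra.
From mathcomp Require Import all_classical all_reals all_analysis.
From mathcomp Require Import measurable_realfun lra ring.
Set Implicit Arguments.
Unset Strict Implicit.
Unset Printing Implicit Defensive.
Import Order.TTheory GRing.Theory Num.Theory.
Import numFieldNormedType.Exports.
Local Open Scope classical_set_scope.
Local Open Scope ring_scope.

(* The curve parameter of a generalized bicharacteristic is an affine function
   of time, so a geodesic y is continuous; and a Riemannian ball U is open,
   since straight segments in a chart have length controlled by the Euclidean
   distance.  If y is periodic, it spends a positive time in a ball centred at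
   y 0 during each period.  If y is uniformly distributed, the limit
   vol U / vol M is positive: vol U > 0 because det g > 0 in charts, and
   vol M is finite by compactness. *)

(** * Positive definite matrices and iterated integrals *)

Lemma cvg_det (R : realFieldType) (T : Type) (F : set_system T) {FF : Filter F}
    (n : nat) (G : T -> 'M[R]_n) (G0 : 'M[R]_n) :
  (forall i j, G t i j @[t --> F] --> G0 i j) ->
  \det (G t) @[t --> F] --> \det G0.
Proof.
move=> GG0; rewrite /determinant.
apply: cvg_big => [|s _]; first exact: add_continuous.
apply: cvgM; first exact: cvg_cst.
by apply: cvg_big => [|i _]; [exact: mul_continuous|exact: GG0].
Qed.

Definition posdefmx (R : realFieldType) n (G : 'M[R]_n) : Prop :=
  forall w : 'rV[R]_n, w != 0 -> 0 < (w *m G *m w^T) 0 0.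

Lemma posdefmx_unit (R : realFieldType) n (G : 'M[R]_n) :
  posdefmx G -> G \in unitmx.
Proof.
move=> Gpos; rewrite -row_free_unit; apply: inj_row_free => w wG.
apply/eqP/negP => /negP w0; have := Gpos _ w0.
by rewrite wG mul0mx mxE ltxx.
Qed.

Lemma normsq_gt0 (R : realFieldType) n (w : 'rV[R]_n) :
  w != 0 -> 0 < (w *m w^T) 0 0.
Proof.
move=> w0; rewrite mxE lt_neqAle sumr_ge0 ?andbT; last first.
  by move=> i _; rewrite mxE -expr2 sqr_ge0.
rewrite eq_sym psumr_eq0; last by move=> i _; rewrite mxE -expr2 sqr_ge0.
apply: contra w0 => /allP w0; apply/eqP/rowP => i.
have := w0 i (mem_index_enum i); rewrite !mxE -expr2 sqrf_eq0 => /eqP; exact.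
Qed.

(* The segment from the identity to G consists of positive definite, hence
   invertible, matrices, so the determinant keeps its sign along it. *)
Lemma posdefmx_det_gt0 (R : realType) n (G : 'M[R]_n) :
  posdefmx G -> 0 < \det G.
Proof.
move=> Gpos; pose H (t : R) : 'M[R]_n := (1 - t) *: 1%:M + t *: G.
have Hdet t : 0 <= t <= 1 -> \det (H t) != 0.
  move=> /andP[t0 t1]; rewrite -unitfE -unitmxE.
  apply: posdefmx_unit => w w0.
  rewrite mulmxDr mulmxDl -!scalemxAr -!scalemxAl mulmx1 !mxE.
  have w1 := normsq_gt0 w0; have := Gpos w w0.
  rewrite !mxE in w1 *; move=> w2.
  have [->|tn0] := eqVneq t 0; first by rewrite subr0 mul1r mul0r addr0.
  by rewrite ltr_wpDl ?mulr_ge0 ?subr_ge0 ?(ltW w1)// mulr_gt0// lt0r tn0.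
have H0 : \det (H 0) = 1 by rewrite /H subr0 scale1r scale0r addr0 det1.
have H1 : H 1 = G by rewrite /H subrr scale1r scale0r add0r.
rewrite ltNge; apply/negP => detG.
have [|||t tin Ht] := @IVT R (fun t => \det (H t)) 0 1 0.
- exact: ler01.
- apply: continuous_subspaceT => t; apply: cvg_det => i j.
  rewrite /H !mxE; under eq_fun do rewrite !mxE.
  apply: cvgD; apply: cvgM; try exact: cvg_cst.
  + by apply: cvgB; [exact: cvg_cst|exact: cvg_id].
  + exact: cvg_id.
- by rewrite H0 H1 ge_min le_max detG ler01 orbT.
by move: (Hdet t); rewrite Ht eqxx => /(_ _)/negP; apply.
Qed.

Section lebint.
Context {R : realType}.
Local Open Scope ereal_scope.

(** The integral of a nonnegative function is the supremum over the simple functions below it, and a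
    simple function below [f1] is also below [f2]. The point is that no measurability is asked, so
    that the partial integrals inside [lebint] can be compared directly. *)
Lemma ge0_le_integral_nomeas d (T : measurableType d)
    (mu : {measure set T -> \bar R}) (D : set T) (f1 f2 : T -> \bar R) :
  (forall x, D x -> 0 <= f1 x) -> (forall x, D x -> f1 x <= f2 x) ->
  \int[mu]_(x in D) f1 x <= \int[mu]_(x in D) f2 x.
Proof.
move=> f10 f12.
have f20 x : D x -> 0 <= f2 x by move=> Dx; exact: le_trans (f10 _ Dx) (f12 _ Dx).
rewrite !ge0_integralE//; apply: ereal_sup_le => _ [h hf <-].
exists h => // x; apply: le_trans (hf x) _.
by rewrite !patchE; case: ifPn => // /set_mem; exact: f12.
Qed.

Lemma lebint_ge0 n (f : 'rV[R]_n -> \bar R) :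
  (forall v, 0 <= f v) -> 0 <= lebint f.
Proof.
elim: n f => [|n IH] f f0 //=.
by apply: integral_ge0 => x _; apply: IH.
Qed.

Lemma le_lebint n (f1 f2 : 'rV[R]_n -> \bar R) :
  (forall v, 0 <= f1 v) -> (forall v, f1 v <= f2 v) ->
  lebint f1 <= lebint f2.
Proof.
elim: n f1 f2 => [|n IH] f1 f2 f10 f12 //=.
apply: ge0_le_integral_nomeas => x _; first exact: lebint_ge0.
exact: IH.
Qed.

Definition box n (a : 'rV[R]_n) (r : R) : set 'rV[R]_n :=
  [set v | forall i, (a 0 i <= v 0 i <= a 0 i + r)%R].

(** The indicator of a box is a product of the indicator of an interval in the first coordinate and
    that of a box in the others. The constant [k] is part of the statement so that the induction
    hypothesis can absorb the first factor. *)
Lemma lebint_box n (a : 'rV[R]_n) (r k : R) : (0 <= r)%R -> (0 <= k)%R ->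
  lebint (fun v => (k * \1_(box a r) v)%:E) = (k * r ^+ n)%:E.
Proof.
move=> r0; elim: n a k => [|n IH] a k k0 /=.
  by rewrite indicE mem_set ?mulr1 ?expr0 ?mulr1//; case.
pose a' : 'rV[R]_n := \row_i a 0%R (rshift 1 i).
have boxE x (v : 'rV[R]_n) : (\1_(box a r) (row_mx (x%:M : 'M[R]_1) v) =
    \1_(`[a 0 0, a 0 0 + r]%classic) x * \1_(box a' r) v :> R)%R.
  rewrite !indicE -natrM mulnb; congr (_%:R)%R; congr nat_of_bool.
  have l0 : @lshift 1 n ord0 = ord0 :> 'I_(1 + n) by exact/val_inj.
  apply/idP/andP => [/set_mem vx|[/set_mem/= + /set_mem vx]].
    split; apply/mem_set.
      have := vx (@lshift 1 n ord0 : 'I_(1 + n)).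
      by rewrite (@row_mxEl _ 1 1 n) !mxE eqxx mulr1n /= in_itv/= l0.
    by move=> i; have := vx (rshift 1 i); rewrite (@row_mxEr _ 1 1 n) /a' !mxE.
  rewrite in_itv/= => xa; apply/mem_set => i.
  case: (splitP (i : 'I_(1 + n))) => j ij.
    have -> : i = lshift n j :> 'I_(1 + n) by apply/val_inj.
    by rewrite (@row_mxEl _ 1 1 n) !ord1 mxE eqxx mulr1n l0.
  have -> : i = rshift 1 j :> 'I_(1 + n) by apply/val_inj.
  by rewrite (@row_mxEr _ 1 1 n); have := vx j; rewrite !mxE.
transitivity (\int[lebesgue_measure]_(x in [set: R])
    ((k * r ^+ n)%:E * (\1_(`[a 0 0, a 0 0 + r]%classic : set R) x)%:E)).
  apply: eq_integral => x _; under eq_fun do rewrite boxE mulrA.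
  by rewrite IH ?mulr_ge0// mulrAC EFinM.
rewrite ge0_integralZl//; first last.
- by rewrite lee_fin mulr_ge0// exprn_ge0.
- by apply/measurable_EFinP; exact: measurable_indic.
have box1 : lebesgue_measure (`[a 0%R 0%R, (a 0 0 + r)%R]%classic : set R) = r%:E.
  rewrite lebesgue_measure_itv/= lte_fin; case: ifPn => [_|].
    by rewrite -EFinB addrAC subrr add0r.
  rewrite ltrDl -leNgt => r1.
  by have -> : r = 0%R by apply/eqP; rewrite eq_le r0 r1.
rewrite integral_indic ?setIT//.
by rewrite [X in _ * X](box1 : _ = r%:E) -EFinM exprSr mulrA.
Qed.
End lebint.

(** * Functions differentiable off an isolated set *)

Section off.
Context {R : realType}.
Implicit Types (B : set R) (f : R -> R).

(** Such a set is discrete but need not be closed: reflections may accumulate at a point outside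
    [B]. *)
Definition punctured_isolated B : Prop :=
  forall b, B b -> \forall s \near b^', ~ B s.

(* B has isolated points only, so its complement is dense and the difference
   quotient bound extends to B by continuity of f. *)
Lemma deriv_off_bound B f s : punctured_isolated B -> continuous f ->
  ~ B s -> has_deriv_off B f s 0 ->
  forall e, 0 < e -> \forall h \near 0^', `|f (s + h) - f s| <= e * `|h|.
Proof.
move=> isoB cf Bs dfs e e0.
have := cvgr0_norm_le _ dfs _ e0; rewrite near_withinE => H0.
have : \forall h \near (0 : R)^', ~ B (s + h) ->
    `|f (s + h) - f s| <= e * `|h|.
  near=> h => Bh.
  have h0 : h != 0 by near: h; exact: nbhs_dnbhs_neq.
  have : `|h^-1 *: (f (s + h) - f s)| <= e by move: Bh; near: h; exact: H0.
  by rewrite normrM normfV ler_pdivrMl ?normr_gt0// mulrC.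
move=> /(@nbhs_ballP R R^o)[d /= d0 Hd].
apply/(@nbhs_ballP R R^o); exists d => //= h hd h0.
have [Bh|Bh] := pselect (B (s + h)); last exact: Hd.
have cvl : `|f u - f s| @[u --> (s + h)^'] --> `|f (s + h) - f s|.
  apply: cvg_norm; apply: cvgB; last exact: cvg_cst.
  by apply: cvg_within_filter; exact: cf.
have cvr : e * `|u - s| @[u --> (s + h)^'] --> e * `|h|.
  rewrite [X in _ --> e * `|X|](_ : h = s + h - s); last by rewrite addrAC subrr add0r.
  apply: cvgM; first exact: cvg_cst.
  apply: cvg_norm; apply: cvgB; last exact: cvg_cst.
  by apply: cvg_within_filter; exact: cvg_id.
apply: (ler_cvg_to cvl cvr).
near=> u.
have -> : u = s + (u - s) by rewrite addrCA subrr addr0.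
have -> : s + (u - s) - s = u - s by rewrite addrAC subrr add0r.
apply: Hd.
- rewrite /ball/= sub0r normrN; near: u.
  apply: (@cvgr_norm_lt _ _ _ _ _ (fun u => u - s) (s + h - s)).
    apply: cvgB; last exact: cvg_cst.
    by apply: cvg_within_filter; exact: cvg_id.
  by move: hd; rewrite /ball/= sub0r normrN addrAC subrr add0r.
- suff : u - s != 0 by [].
  near: u; apply: (@cvgr_neq0 _ _ _ _ _ (fun u => u - s) (s + h - s)).
    apply: cvgB; last exact: cvg_cst.
    by apply: cvg_within_filter; exact: cvg_id.
  by rewrite addrAC subrr add0r.
- by rewrite addrCA subrr addr0; near: u; exact: isoB.
Unshelve. all: by end_near.
Qed.

Lemma is_derive0_bound f s :
  (forall e, 0 < e -> \forall h \near 0^', `|f (s + h) - f s| <= e * `|h|) ->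
  is_derive s 1 f 0.
Proof.
move=> H; have lim0 :
    h^-1 *: ((f \o shift s) (h *: (1 : R)) - f s) @[h --> 0^'] --> (0 : R).
  apply/cvgr0Pnorm_le => e e0; near=> h.
  have h0 : h != 0 by near: h; exact: nbhs_dnbhs_neq.
  rewrite normrM normfV ler_pdivrMl ?normr_gt0// [`|h| * e]mulrC /= [h *: 1]mulr1 [h + s]addrC.
  by near: h; exact: H.
apply: DeriveDef; first by apply/cvg_ex; exists 0.
exact: cvg_lim lim0.
Unshelve. all: by end_near.
Qed.

(** Off [B] the derivative of [f] is an ordinary zero derivative. A point [s] of [B] has a punctured
    neighbourhood off [B], so by continuity at [s] the mean value theorem makes [f] constant near
    [s]. Hence the derivative vanishes everywhere. *)
Lemma deriv_off_const B f : punctured_isolated B -> continuous f ->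
  (forall s, ~ B s -> has_deriv_off B f s 0) -> forall x y, f x = f y.
Proof.
move=> isoB cf df x y; apply: is_derive_0_is_cst => s.
have dB u : ~ B u -> is_derive u 1 f 0.
  by move=> Bu; apply: is_derive0_bound; apply: (deriv_off_bound isoB) => //; exact: df.
have [Bs|] := pselect (B s); last exact: dB.
apply: is_derive0_bound => e e0.
have := isoB _ Bs; move=> /(@nbhs_ballP R R^o)[d /= d0 Hd].
apply/(@nbhs_ballP R R^o); exists d => //= h hd h0.
suff -> : f (s + h) = f s by rewrite subrr normr0 mulr_ge0// ltW.
have cfw (A : set R) : {within A, continuous f} by exact: continuous_subspaceT.
have inB u : `|u - s| < `|h| -> u != s -> is_derive u 1 f 0.
  move=> us un; apply: dB; apply: Hd => //.
  move: hd; rewrite /ball/= sub0r normrN; apply: lt_trans.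
  by rewrite distrC.
have [hp|hn] := ltP 0 h.
- have [|u|c _] := @MVT_segment R f (cst 0) s (s + h) _ _ (cfw _).
  + by rewrite lerDl ltW.
  + rewrite in_itv/= => /andP[su us]; apply: inB; last by rewrite gt_eqF.
    by rewrite !gtr0_norm ?subr_gt0// ltrBlDl.
  + by rewrite /= mul0r => /eqP; rewrite subr_eq0 => /eqP.
- have hlt : h < 0 by rewrite lt_neqAle hn andbT.
  have [|u|c _] := @MVT_segment R f (cst 0) (s + h) s _ _ (cfw _).
  + by rewrite gerDl.
  + rewrite in_itv/= => /andP[su us]; apply: inB; last by rewrite lt_eqF.
    rewrite distrC gtr0_norm ?subr_gt0// ltr0_norm// ltrBlDl.
    by rewrite ltrBrDr.
  + by rewrite /= mul0r => /eqP; rewrite subr_eq0 => /eqP.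
Qed.

Lemma deriv_off_affine B f c : punctured_isolated B -> continuous f ->
  (forall s, ~ B s -> has_deriv_off B f s c) ->
  forall s, f s = f 0 + c * s.
Proof.
move=> isoB cf df s.
suff : f s - c * s = f 0 - c * 0 by rewrite mulr0 subr0 => /eqP; rewrite subr_eq => /eqP.
apply: (@deriv_off_const B (fun u => f u - c * u)) => // [u|u Bu].
  by apply: cvgB; [exact: cf|apply: cvgM; [exact: cvg_cst|exact: cvg_id]].
rewrite /has_deriv_off.
have : h^-1 *: (f (u + h) - f u) - c
    @[h --> within (fun h => ~ B (u + h)) (0 : R)^'] --> c - c.
  by apply: cvgB; [exact: df|exact: cvg_cst].
rewrite subrr => H; apply: cvg_trans H; apply: near_eq_cvg.
rewrite near_withinE; near=> h => _.
have h0 : h != 0 by near: h; exact: nbhs_dnbhs_neq.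
by rewrite /GRing.scale/=; field.
Unshelve. all: by end_near.
Qed.

End off.

(** * Time along a generalized bicharacteristic *)

Section time_component.
Context {R : realType} {M : ptopologicalType} {n : nat}.
Context {A : smooth_manifold R M n}.
Variable g : riem_metric A.
Local Notation phase := ('rV[R]_(n.+1 + 1) * 'rV[R]_(n.+1 + 1))%type.
Implicit Types (c : chart R M n) (w v : phase).

Local Notation time := (rshift n.+1 (ord0 : 'I_1)).

Lemma gmx_posdefmx c (v : 'rV[R]_n.+1) : atlas A c -> cimg c v -> posdefmx (gmx g c v).
Proof. by move=> Ac cv w; exact: gmx_posdef. Qed.

Lemma lsubmx_add_time (u : 'rV[R]_(n.+1 + 1)) h :
  lsubmx (u + h *: delta_mx 0 time) = lsubmx u.
Proof. by apply/rowP => i; rewrite !mxE eqxx/= eq_lrshift mulr0 addr0. Qed.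

(** The metric does not depend on time, so the difference quotient is identically zero. This is what
    makes [tau] a conserved quantity. *)
Lemma wave_symbol_base_time c w : pd_base (wave_symbol g c) time w = 0.
Proof.
rewrite /pd_base /rderive /wave_symbol.
under eq_fun => h.
  rewrite /= lsubmx_add_time scaler0 addr0 subrr mulr0.
  over.
exact: lim_cst.
Qed.

Lemma wave_symbol_fiber_time c w :
  pd_fiber (wave_symbol g c) time w = - 2 * w.2 0 time.
Proof.
rewrite /pd_fiber /rderive /wave_symbol.
pose tau := w.2 0 time.
(* The quadratic form in xi cancels, and the difference quotient of the remaining term, minus the
   square of [tau], is exactly [- (2 * tau + h)]. *)
have H : - (2 * tau + h) @[h --> (0 : R)^'+] --> - (2 * tau + 0).
  apply: cvgN; apply: cvgD; first exact: cvg_cst.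
  by apply: cvg_within_filter; exact: cvg_id.
rewrite mulNr -[2 * _]addr0.
apply: cvg_lim => //; apply: cvg_trans H; apply: near_eq_cvg.
near=> h; have h0 : h != 0 by rewrite gt_eqF//; near: h; exact: nbhs_right_gt.
rewrite /= lsubmx_add_time scaler0 addr0 /tau.
move: (_ *m _ *m _) => Q.
rewrite ![rsubmx _ _ _]mxE [fun_of_matrix (_ + _) _ _]mxE.
rewrite [fun_of_matrix (_ *: _) _ _]mxE.
rewrite [delta_mx _ _ _ _]mxE !eqxx mulr1.
by field.
Unshelve. all: by end_near.
Qed.

Lemma bdry_fun_fiber (i : 'I_(n.+1 + 1)) w :
  pd_fiber (@bdry_fun R n) i w = 0.
Proof.
rewrite /pd_fiber /rderive /bdry_fun.
under eq_fun do rewrite /= scaler0 addr0 subrr mulr0.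
exact: lim_cst.
Qed.

Lemma bdry_fun_base_time w : pd_base (@bdry_fun R n) time w = 0.
Proof.
rewrite /pd_base /rderive /bdry_fun.
under eq_fun do rewrite /= !mxE eqxx eq_lrshift mulr0 addr0 subrr mulr0.
exact: lim_cst.
Qed.

Lemma ham_field_time c w :
  (ham_field (wave_symbol g c) w).1 0 time = - 2 * w.2 0 time /\
  (ham_field (wave_symbol g c) w).2 0 time = 0.
Proof.
by rewrite /ham_field/= !mxE wave_symbol_base_time wave_symbol_fiber_time oppr0.
Qed.

(** The gliding correction is a multiple of the Hamilton field of [bdry_fun], which depends on the
    first space coordinate only. Its time components vanish, so the value of the coefficient does
    not matter. *)
Lemma gliding_field_time c w :
  (gliding_field (wave_symbol g c) (@bdry_fun R n) w).1 0 time = - 2 * w.2 0 time /\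
  (gliding_field (wave_symbol g c) (@bdry_fun R n) w).2 0 time = 0.
Proof.
rewrite /gliding_field/= !mxE wave_symbol_base_time wave_symbol_fiber_time.
by rewrite bdry_fun_base_time bdry_fun_fiber !(oppr0, mulr0, addr0).
Qed.

Lemma has_deriv_off_fst (B : set R) (f : R -> phase) s v i :
  has_deriv_off B f s v -> has_deriv_off B (fun u => (f u).1 0 i) s (v.1 0 i).
Proof.
move=> H; rewrite /has_deriv_off.
have : ((fun w : phase => w.1 0 i) \o (fun h => h^-1 *: (f (s + h) - f s))) h
    @[h --> within (fun h => ~ B (s + h)) (0 : R)^'] --> v.1 0 i.
  apply: (@cvg_comp _ _ _ (fun h => h^-1 *: (f (s + h) - f s))
    (fun w : phase => w.1 0 i) _ (nbhs v) _ H).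
  apply: (@cvg_comp _ _ _ fst (fun u : 'rV[R]_(n.+1 + 1) => u 0 i)).
    exact: cvg_fst.
  exact: coord_continuous.
by under eq_fun do rewrite /= !mxE.
Qed.

Lemma has_deriv_off_snd (B : set R) (f : R -> phase) s v i :
  has_deriv_off B f s v -> has_deriv_off B (fun u => (f u).2 0 i) s (v.2 0 i).
Proof.
move=> H; rewrite /has_deriv_off.
have : ((fun w : phase => w.2 0 i) \o (fun h => h^-1 *: (f (s + h) - f s))) h
    @[h --> within (fun h => ~ B (s + h)) (0 : R)^'] --> v.2 0 i.
  apply: (@cvg_comp _ _ _ (fun h => h^-1 *: (f (s + h) - f s))
    (fun w : phase => w.2 0 i) _ (nbhs v) _ H).
  apply: (@cvg_comp _ _ _ snd (fun u : 'rV[R]_(n.+1 + 1) => u 0 i)).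
    exact: cvg_snd.
  exact: coord_continuous.
by under eq_fun do rewrite /= !mxE.
Qed.

Section bicharacteristic.
Context {B : set R} {t tau : R -> R} {x : R -> M}.
Context {xi : R -> chart R M n -> 'rV[R]_n.+1}.
Hypothesis gb : gen_bicharacteristic g B t tau x xi.

Lemma reflections_isolated : punctured_isolated B.
Proof.
by move=> b Bb; have := gb_reflect_isolated gb Bb; apply: filterS => s [].
Qed.

Lemma coords_time c s : (coords t tau x xi c s).1 0 time = t s /\
  (coords t tau x xi c s).2 0 time = tau s.
Proof. by rewrite /coords/= !row_mxEr !mxE eqxx. Qed.

(** Free and gliding points are governed by different fields, but both fields have the same time
    components. *)
Lemma bicharacteristic_deriv_time s : ~ B s ->
  has_deriv_off B t s (- 2 * tau s) /\ has_deriv_off B tau s 0.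
Proof.
move=> Bs; have [c Ac cs] := atlas_cover A (x s).
have cxs : chart_around A (x s) c by [].
set w := coords t tau x xi c s.
have [v dv [v1 v2]] : exists2 v, has_deriv_off B (coords t tau x xi c) s v &
    v.1 0 time = - 2 * w.2 0 time /\ v.2 0 time = 0.
  have [|/not_orP[/contrapT bx nd]] :=
      pselect (~ bdry A (x s) \/ diffractive (wave_symbol g c) (@bdry_fun R n) w).
    move=> /(gb_free gb Bs cxs) dv.
    by eexists; [exact: dv|exact: ham_field_time].
  by eexists; [exact: (gb_gliding gb Bs cxs bx nd)|exact: gliding_field_time].
split.
- have := has_deriv_off_fst (i := time) dv.
  rewrite v1 (coords_time c s).2.
  by congr (has_deriv_off B _ s _); apply/funext => u; rewrite (coords_time c u).1.
- have := has_deriv_off_snd (i := time) dv.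
  rewrite v2.
  by congr (has_deriv_off B _ s _); apply/funext => u; rewrite (coords_time c u).2.
Qed.

Lemma exists_nonreflection : exists s, ~ B s.
Proof.
have [B0|] := pselect (B 0); last by exists 0.
have [s Bs] := @filter_ex _ _ (Proper_dnbhs_numFieldType 0) _ (reflections_isolated B0).
by exists s.
Qed.

(** Since [tau] is constant, so is the derivative [- 2 * tau] of [t]. If [tau] were zero, the
    characteristic equation at a point off [B] would force xi to vanish as well, contradicting
    [gb_nonzero]. *)
Lemma bicharacteristic_time_affine :
  exists2 k : R, k != 0 & forall s, t s = t 0 + k * s.
Proof.
have tau_cst s : tau s = tau 0.
  apply: (deriv_off_const reflections_isolated (gb_tau_continuous gb)) => u Bu.
  exact: (bicharacteristic_deriv_time Bu).2.
exists (- 2 * tau 0); last first.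
  apply: (deriv_off_affine reflections_isolated (gb_t_continuous gb)) => s Bs.
  by rewrite -(tau_cst s); exact: (bicharacteristic_deriv_time Bs).1.
rewrite mulf_neq0 ?oppr_eq0 ?pnatr_eq0//; apply/negP => /eqP tau0.
have [s Bs] := exists_nonreflection.
have [c Ac cs] := atlas_cover A (x s).
have cxs : chart_around A (x s) c by [].
have := gb_nonzero gb Bs cxs; have := gb_characteristic gb Bs cxs.
rewrite /wave_symbol /coords/= !row_mxKl row_mxKr [fun_of_matrix _%:M _ _]mxE eqxx mulr1n.
rewrite tau_cst tau0 expr0n/= subr0 => xi0 /negP; apply.
set G := gmx g c _ in xi0.
have Gpos : posdefmx G by apply: gmx_posdefmx => //; exists (x s).
have Gunit := posdefmx_unit Gpos.
have [->|w0] := eqVneq (xi s c) 0.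
  apply/eqP/rowP => i; rewrite !mxE; case: splitP => j _; rewrite !mxE//.
  by rewrite mul0rn.
have Gsym : G^T = G by apply: gmx_sym => //; exists (x s).
(* The dual form at xi equals the form of [G] at [xi *m invmx G], so positivity of [G] carries over
   to its inverse. *)
have /Gpos : xi s c *m invmx G != 0.
  apply: contra w0 => /eqP w0.
  by rewrite -[xi s c](mulmxKV Gunit) w0 mul0mx.
rewrite mulmxKV// trmx_mul trmx_inv Gsym mulmxA => Gw.
by move: Gw; rewrite xi0 ltxx.
Qed.

Lemma bicharacteristic_reparam_continuous y :
  (forall s, y (t s) = x s) -> continuous y.
Proof.
move=> yx; have [k k0 tk] := bicharacteristic_time_affine.
have -> : y = x \o (fun u => (u - t 0) / k).
  by apply/funext => u /=; rewrite -yx tk; congr (y _); field.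
move=> u; apply: continuous_comp; last exact: gb_x_continuous gb _.
apply: cvgM; last exact: cvg_cst.
by apply: cvgB; [exact: cvg_id|exact: cvg_cst].
Qed.
End bicharacteristic.

Lemma geodesic_continuous y : geodesic g y -> continuous y.
Proof.
move=> [B [t [tau [x [xi [gb yx]]]]]].
exact: (bicharacteristic_reparam_continuous gb yx).
Qed.
End time_component.

(** * Riemannian balls *)

Section local_geometry.
Context {R : realType} {M : ptopologicalType} {n : nat}.
Context {A : smooth_manifold R M n}.
Variable g : riem_metric A.
Implicit Types (c : chart R M n) (a v : 'rV[R]_n.+1).

Lemma smooth_on_within (S : set 'rV[R]_n.+1) (f : 'rV[R]_n.+1 -> R) a :
  smooth_on S f -> S a -> f v @[v --> within S (nbhs a)] --> f a.
Proof.
move=> fS Sa; have [W [F [oW Wa CF FW]]] := fS a Sa.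
have cF : F v @[v --> within S (nbhs a)] --> f a.
  rewrite -(FW a Wa Sa); apply: cvg_within_filter.
  (* The empty list of derivatives gives differentiability of the extension [F] itself. *)
  exact: (differentiable_continuous (CF [::] a Wa)).
apply: cvg_trans cF; apply: near_eq_cvg; rewrite near_withinE.
have : \forall v \near a, W v by exact: open_nbhs_nbhs.
by apply: filterS => v Wv Sv; rewrite FW.
Qed.

Lemma det_gmx_within c a : atlas A c -> cimg c a ->
  \det (gmx g c v) @[v --> within (cimg c) (nbhs a)] --> \det (gmx g c a).
Proof.
move=> Ac ca; apply: cvg_det => i j.
by apply: smooth_on_within => //; exact: gmx_smooth.
Qed.

Lemma cimg_halfspace c a : cimg c a -> 0 <= a 0 ord0.
Proof. by have [V _ cV] := cmap_open c; rewrite /cimg cV => -[]. Qed.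

(** A chart image is an open set cut by the half-space, so near [a] the only condition for lying in
    it is the sign of the first coordinate. This treats interior and boundary points alike. *)
Lemma within_cimg_ball c a (P : set 'rV[R]_n.+1) : cimg c a ->
  (\forall v \near within (cimg c) (nbhs a), P v) ->
  exists2 r, 0 < r & forall v, (forall i, `|a 0 i - v 0 i| < r) ->
    0 <= v 0 ord0 -> cimg c v /\ P v.
Proof.
have [V oV cV] := cmap_open c; move=> ca; rewrite near_withinE => Pa.
have Va : V a by move: ca; rewrite /cimg cV => -[].
have /nbhs_ballP[r r0 Hr] : nbhs a ([set v | cimg c v -> P v] `&` V).
  by apply: filterI => //; exact: open_nbhs_nbhs.
exists r => // v av v0.
have [Pv Vv] : ([set v | cimg c v -> P v] `&` V) v.
  by apply: Hr; split => // i j; rewrite (ord1 i); exact: av.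
have cv : cimg c v by rewrite /cimg cV.
by split => //; exact: Pv.
Qed.

Lemma cmap_cvg c z : cdom c z -> cmap c z' @[z' --> z] --> cmap c z.
Proof.
have := @cmap_continuous _ _ _ c; rewrite continuous_open_subspace; last exact: cdom_open.
by move=> cc cz; apply: cc; exact/mem_set.
Qed.

Lemma cinv_cvg c z : cdom c z ->
  cinv c v @[v --> within (cimg c) (nbhs (cmap c z))] --> z.
Proof.
move=> cz; rewrite -[X in _ --> X](cmapK cz).
by have /subspace_continuousP := @cinv_continuous _ _ _ c; apply; exists z.
Qed.

Lemma near_chart c z (P : set M) : cdom c z -> (\forall z' \near z, P z') ->
  \forall z' \near z, cdom c z' /\ P z'.
Proof.
move=> cz Pz; apply: filterI => //.
exact: open_nbhs_nbhs (conj (cdom_open c) cz).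
Qed.

Lemma near_cmap c z r : cdom c z -> 0 < r ->
  \forall z' \near z, cdom c z' /\ forall i, `|cmap c z 0 i - cmap c z' 0 i| < r.
Proof.
move=> cz r0; apply: near_chart => //.
have H : \forall z' \near z, ball (cmap c z) r (cmap c z').
  by apply: (cmap_cvg cz); exact: nbhsx_ballx.
by apply: filterS H => z' [_ H] i; exact: H.
Qed.

Lemma quadratic_form_le (G : 'M[R]_n.+1) (u : 'rV[R]_n.+1) K e :
  0 <= e -> (forall i j, `|G i j| <= K) -> (forall i, `|u 0 i| <= e) ->
  (u *m G *m u^T) 0 0 <= (n.+1%:R ^+ 2 * K) * e ^+ 2.
Proof.
move=> e0 GK ue.
have K0 : 0 <= K by apply: le_trans (GK ord0 ord0).
rewrite mxE.
have Hj j : (u *m G) 0 j * u^T j 0 <= n.+1%:R * (K * e ^+ 2).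
  rewrite !mxE mulr_suml.
  have : n.+1%:R * (K * e ^+ 2) = \sum_(i < n.+1) K * e ^+ 2.
    by rewrite sumr_const card_ord mulr_natl.
  move=> ->; apply: ler_sum => i _.
  apply: le_trans (ler_norm _) _; rewrite !normrM [K * _]mulrC expr2 mulrAC.
  by apply: ler_pM; rewrite ?mulr_ge0//; apply: ler_pM.
have -> : (n.+1%:R ^+ 2 * K) * e ^+ 2 = \sum_(i < n.+1) n.+1%:R * (K * e ^+ 2).
  by rewrite sumr_const card_ord -[RHS]mulr_natl expr2 !mulrA.
exact: ler_sum.
Qed.

Lemma gmx_bounded c a : atlas A c -> cimg c a ->
  exists2 K, 0 < K & \forall v \near within (cimg c) (nbhs a),
    forall i j, `|gmx g c v i j| <= K.
Proof.
move=> Ac ca.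
(* The sum dominates every entry at [a] at once; the margin 1 leaves room for continuity. *)
pose K := \sum_i \sum_j (`|gmx g c a i j| + 1).
have Kge i j : `|gmx g c a i j| + 1 <= K.
  rewrite /K (bigD1 i)//= (bigD1 j)//= -addrA lerDl addr_ge0//.
    by apply: sumr_ge0 => k _; rewrite addr_ge0.
  by apply: sumr_ge0 => k _; apply: sumr_ge0 => l _; rewrite addr_ge0.
exists K; first by apply: lt_le_trans (Kge ord0 ord0); rewrite ltr_wpDl.
have Hij (i j : 'I_n.+1) :
    \forall v \near within (cimg c) (nbhs a), `|gmx g c v i j| <= K.
  have cg : gmx g c v i j @[v --> within (cimg c) (nbhs a)] --> gmx g c a i j.
    by apply: smooth_on_within => //; exact: gmx_smooth.
  have : `|gmx g c a i j| < K by apply: lt_le_trans (Kge i j); rewrite ltrDl.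
  by move=> /(cvgr_norm_lt _ cg); apply: filterS => v /ltW.
have : \forall v \near within (cimg c) (nbhs a),
    forall ij : 'I_n.+1 * 'I_n.+1, `|gmx g c v ij.1 ij.2| <= K.
  by apply: filter_forall => -[i j]; exact: Hij.
by apply: filterS => v H i j; exact: (H (i, j)).
Qed.

(** The two points are joined by a straight segment in a chart, which stays in the half-space by
    convexity. Its coordinate velocity is constant and the metric is bounded near [z], which bounds
    its length. *)
Lemma riem_dist_near z (d : R) : 0 < d ->
  \forall z' \near z, (riem_dist g z z' < d%:E)%E.
Proof.
move=> d0; have [c Ac cz] := atlas_cover A z.
set a := cmap c z; have ca : cimg c a by exists z.
have [K K0 Kle] := gmx_bounded Ac ca.
have [r r0 Hr] := within_cimg_ball ca Kle.
pose C := n.+1%:R ^+ 2 * K.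
have C0 : 0 < C by rewrite mulr_gt0// exprn_gt0.
(* The bound by [r] keeps the segment where the entries of the metric are at most [K]; the other one
   makes the speed, at most [Num.sqrt C * e], no larger than [d / 2]. *)
pose e := Num.min r (d / 2 / Num.sqrt C).
have sC0 : 0 < Num.sqrt C by rewrite sqrtr_gt0.
have e0 : 0 < e by rewrite lt_min r0 !divr_gt0.
apply: filterS (near_cmap cz e0) => z' [cz' az'].
set b := cmap c z' in az'.
pose f (s : R) : 'rV[R]_n.+1 := a + s *: (b - a).
have f0 : f 0 = a by rewrite /f scale0r addr0.
have f1 : f 1 = b by rewrite /f scale1r addrC subrK.
have df (s : R) : is_derive s (1 : R) f (b - a).
  have lim_f : h^-1 *: ((f \o shift s) (h *: (1 : R)) - f s) @[h --> 0^'] --> b - a.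
    have cst_ba : (b - a) @[_ --> (0 : R)^'] --> b - a by exact: cvg_cst.
    apply: cvg_trans cst_ba; apply: near_eq_cvg; near=> h.
    have h0 : h != 0 by near: h; exact: nbhs_dnbhs_neq.
    rewrite /f /= [h *: 1]mulr1 scalerDl opprD addrACA subrr add0r addrK.
    by rewrite scalerA mulVf// scale1r.
  apply: DeriveDef; first by apply/cvg_ex; exists (b - a).
  exact: cvg_lim lim_f.
have df1 : derive1 f = cst (b - a).
  by apply/funext => s; rewrite derive1E derive_val.
have fr s : 0 <= s <= 1 -> cimg c (f s) /\ forall i j, `|gmx g c (f s) i j| <= K.
  move=> /andP[s0 s1]; apply: Hr.
    move=> i; rewrite /f !mxE opprD addrA subrr sub0r normrN normrM ger0_norm//.
    apply: le_lt_trans (_ : _ <= `|a 0 i - b 0 i|) _.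
      by rewrite distrC ler_piMl.
    by apply: lt_le_trans (az' i) _; rewrite ge_min lexx.
  rewrite /f !mxE; have a0 := cimg_halfspace ca.
  have b0 : 0 <= b 0 ord0 by apply: (@cimg_halfspace c); exists z'.
  have -> : a 0 ord0 + s * (b 0 ord0 - a 0 ord0) =
      (1 - s) * a 0 ord0 + s * b 0 ord0 by ring.
  by rewrite addr_ge0 ?mulr_ge0// subr_ge0.
have arc := @length_arc _ _ _ _ g c 0 1 f Ac ler01.
rewrite df1 f0 f1 !cmapK// in arc.
have {}arc := arc (fun s => @ex_derive _ _ _ _ _ _ _ (df s))
  (@cst_continuous _ _ (b - a))
  (fun s s01 => (fr s s01).1).
apply: le_lt_trans (ereal_inf_lbound arc) _.
apply: (@le_lt_trans _ _ (\int[lebesgue_measure]_(s in `[0%R, 1%R]) (d / 2)%:E)%E).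
  apply: ge0_le_integral_nomeas => s; first by rewrite lee_fin sqrtr_ge0.
  rewrite /= in_itv/= => s01; rewrite lee_fin.
  have : (cst (b - a) s *m gmx g c (f s) *m (cst (b - a) s)^T) 0 0 <= C * e ^+ 2.
    apply: quadratic_form_le => [|i j|i]; first exact: ltW.
      exact: (fr s s01).2.
    by rewrite /= !mxE distrC ltW.
  move=> /ler_wsqrtr/le_trans; apply.
  rewrite sqrtrM ?(ltW C0)// sqrtr_sqr ger0_norm ?(ltW e0)//.
  by rewrite mulrC -ler_pdivlMr// ge_min lexx orbT.
rewrite integral_cst//= lebesgue_measure_itv/= lte_fin ltr01 -EFinB subr0 mule1.
by rewrite lte_fin ltr_pdivrMr// ltr_pMr// ltr1n.
Unshelve. all: by end_near.
Qed.

Lemma riem_ball_center z (r : R) : 0 < r -> riem_ball g z r z.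
Proof. by move=> r0; exact: nbhs_singleton (riem_dist_near z r0). Qed.

Lemma riem_ball_open z (r : R) : open (riem_ball g z r).
Proof.
rewrite openE => x /ereal_inf_lt[l zx lr].
(* Lengths are extended reals: the margin is [r - l] for finite [l], and any margin serves for
   [-oo]. A curve to [x] of length [l], continued by a curve shorter than [e], then stays shorter
   than [r]. *)
have [e e0 ler] : exists2 e : R, 0 < e &
    forall l', (l' < e%:E)%E -> (l + l' < r%:E)%E.
  case: l lr {zx} => [l|//|_]; last first.
    by exists 1 => // l' _; rewrite addNye ltNyr.
  rewrite lte_fin -subr_gt0 => lr; exists (r - l) => // -[l'| |]//.
    by rewrite !lte_fin ltrBrDl.
  by move=> _; rewrite addeNy ltNyr.
apply: filterS (riem_dist_near x e0) => x' /ereal_inf_lt[l' xx' l'e].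
by apply: le_lt_trans (ler _ l'e); apply: ereal_inf_lbound; exact: length_cat xx'.
Qed.

End local_geometry.

(** * Riemannian volume *)

Section volume.
Context {R : realType} {M : ptopologicalType} {n : nat}.
Context {A : smooth_manifold R M n}.
Variable g : riem_metric A.
Variable vol : {measure set (g_sigma_algebraType (@open M)) -> \bar R}.
Hypothesis vol_g : is_riem_volume g vol.

Lemma open_borel (U : set M) : open U ->
  measurable (U : set (g_sigma_algebraType (@open M))).
Proof. by move=> oU; exact: sub_sigma_algebra. Qed.

(** A small neighbourhood has its chart image in a box of side [r *+ 2] centred at [a], on which the
    density is at most [Num.sqrt D]. *)
Lemma vol_locally_finite z : exists U : set M, [/\ open U, U z & (vol U < +oo)%E].
Proof.
have [c Ac cz] := atlas_cover A z.
set a := cmap c z; have ca : cimg c a by exists z.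
pose D := \det (gmx g c a) + 1.
have HD : \forall v \near within (cimg c) (nbhs a), \det (gmx g c v) <= D.
  have : \det (gmx g c a) < D by rewrite ltrDl.
  by move=> /(cvgr_lt _ (det_gmx_within Ac ca)); apply: filterS => v /ltW.
have [r r0 Hr] := within_cimg_ball ca HD.
pose P := [set z' | cdom c z' /\ forall i, `|a 0 i - cmap c z' 0 i| < r].
exists (P°); split; first exact: open_interior.
  exact: near_cmap.
have PU : P° `<=` P by exact: interior_subset.
rewrite (vol_g Ac); [|by apply: open_borel; exact: open_interior|by move=> x /PU[]].
pose lo : 'rV[R]_n.+1 := \row_i (a 0 i - r).
apply: (@le_lt_trans _ _ (lebint (fun v => (Num.sqrt D * \1_(box lo (r *+ 2)) v)%:E))).
  apply: le_lebint => v; rewrite lee_fin.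
    by apply: mulr_ge0; [rewrite indicE ler0n|exact: sqrtr_ge0].
  rewrite indicE; case: (boolP (v \in _)) => /= [/set_mem[z' /PU[cz' az'] <-]|_]; last first.
    by rewrite mul0r; apply: mulr_ge0; [exact: sqrtr_ge0|rewrite indicE ler0n].
  rewrite mul1r indicE mem_set ?mulr1; last first.
    move=> i; rewrite mxE; have := az' i; rewrite ltr_norml => /andP[h1 h2].
    by apply/andP; split; lra.
  apply: ler_wsqrtr; apply: (Hr _ az' _).2.
  by apply: (@cimg_halfspace _ _ _ c); exists z'.
by rewrite lebint_box ?mulrn_wge0 ?sqrtr_ge0 ?ltry// ltW.
Qed.

Lemma vol_open_gt0 (U : set M) z : open U -> U z -> (0 < vol U)%E.
Proof.
move=> oU Uz; have [c Ac cz] := atlas_cover A z.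
set a := cmap c z; have ca : cimg c a by exists z.
pose W := U `&` cdom c.
have oW : open W by apply: openI => //; exact: cdom_open.
have Wz : W z by [].
have det0 : 0 < \det (gmx g c a).
  by apply: posdefmx_det_gt0; exact: gmx_posdefmx.
pose k := \det (gmx g c a) / 2.
have k0 : 0 < k by rewrite divr_gt0.
have HW : \forall v \near within (cimg c) (nbhs a),
    W (cinv c v) /\ k <= \det (gmx g c v).
  apply: filterI.
    exact: (cinv_cvg cz (open_nbhs_nbhs (conj oW Wz))).
  have : k < \det (gmx g c a) by rewrite /k ltr_pdivrMr// ltr_pMr// ltr1n.
  by move=> /(cvgr_gt _ (det_gmx_within Ac ca)); apply: filterS => v /ltW.
have [r r0 Hr] := within_cimg_ball ca HW.
have volW : (0 < vol W)%E.
  rewrite (vol_g Ac); [|exact: open_borel|by move=> x []].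
  (* This box has [a] as its lowest corner, so it stays in the half-space even when [z] is a
     boundary point. Its side [r / 2] keeps it within the open range of radius [r]. *)
  apply: (@lt_le_trans _ _ (lebint (fun v => (Num.sqrt k * \1_(box a (r / 2)) v)%:E))).
    rewrite lebint_box ?sqrtr_ge0//; last by rewrite ltW// divr_gt0.
    by rewrite lte_fin mulr_gt0 ?sqrtr_gt0// exprn_gt0// divr_gt0.
  apply: le_lebint => v; rewrite lee_fin.
    by apply: mulr_ge0; [exact: sqrtr_ge0|rewrite indicE ler0n].
  rewrite [\1_(box _ _) _]indicE; case: (boolP (v \in _)) => /= [/set_mem av|_]; last first.
    by rewrite mulr0; apply: mulr_ge0; [rewrite indicE ler0n|exact: sqrtr_ge0].
  have [[z' cz' z'v] [Wv kv]] : cimg c v /\ W (cinv c v) /\ k <= \det (gmx g c v).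
    apply: Hr => [i|].
      by have /andP[h1 h2] := av i; rewrite ltr_norml; apply/andP; split; lra.
    have /andP[+ _] := av ord0; apply: le_trans.
    exact: (cimg_halfspace ca).
  rewrite mulr1 indicE mem_set ?mul1r; last first.
    exists (cinv c v) => //; first by rewrite -z'v cmapK.
  exact: ler_wsqrtr.
apply: lt_le_trans volW _; apply: le_measure; rewrite ?inE; try exact: open_borel.
by move=> x [].
Qed.

(** Finitely many open sets of finite volume cover [M], and the volume is subadditive. *)
Lemma vol_finite : compact [set: M] -> (vol [set: M] < +oo)%E.
Proof.
rewrite compact_cover => cM.
have [U HU] := choice vol_locally_finite.
have [||D _ MD] := cM M setT U.
- by move=> z _; have [] := HU z.
- by move=> z _; exists z => //; have [] := HU z.
have {}MD : [set: M] `<=` \big[setU/set0]_(i <- finmap.enum_fset D) U i.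
  by rewrite -bigcup_fset.
have [mB fB] : measurable (\big[setU/set0]_(i <- finmap.enum_fset D) U i
      : set (g_sigma_algebraType (@open M))) /\
    (vol (\big[setU/set0]_(i <- finmap.enum_fset D) U i) < +oo)%E.
  elim: (finmap.enum_fset D) => [|z s [ms fs]].
    by rewrite big_nil measure0; split => //; exact: measurable0.
  rewrite big_cons; have [oz _ fz] := HU z.
  split; first by apply: measurableU => //; exact: open_borel.
  apply: le_lt_trans (measureU2 _ _ _) _ => //; first exact: open_borel.
  by rewrite lte_add_pinfty.
apply: le_lt_trans fB; apply: le_measure; rewrite ?inE//.
Qed.
End volume.

(** * Occupation times *)

(** The lower limit is a supremum, over the sets of the filter, of infima; the set where [k <= f T]
    is one of them and its infimum is at least [k]. *)
Lemma limf_einf_gt0 (R : realType) (f : R -> R) (k : R) : 0 < k ->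
  (\forall T \near +oo, k <= f T) ->
  (0 < limf_einf (fun T => (f T)%:E) (pinfty_nbhs R))%E.
Proof.
move=> k0 Hk; rewrite limf_einfE; apply: (@lt_le_trans _ _ k%:E) => //.
apply: le_trans (ereal_sup_ubound _); last by exists [set T | k <= f T].
by apply/ereal_infP => _ [T kT <-]; rewrite lee_fin.
Qed.

Section occupation.
Context {R : realType} {M : ptopologicalType}.
Variables (y : R -> M) (U : set M).
Hypotheses (cy : continuous y) (oU : open U).

Definition occupation (T : R) : set R := [set t : R | 0 <= t <= T /\ U (y t)].

Lemma measurable_occupation T : measurable (occupation T).
Proof.
have -> : occupation T = `[0, T]%classic `&` (y @^-1` U).
  by apply/seteqP; split => t /=; rewrite in_itv/=.
apply: measurableI; first exact: measurable_itv.
by apply: open_measurable; apply: open_comp => // t _; exact: cy.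
Qed.

Lemma occupation_fin T : (lebesgue_measure (occupation T) < +oo)%E.
Proof.
apply: (@le_lt_trans _ _ (lebesgue_measure (`[0, T]%classic : set R))).
  apply: le_measure; rewrite ?inE; [exact: measurable_occupation|exact: measurable_itv|].
  by move=> t [t0T _] /=; rewrite in_itv.
by rewrite lebesgue_measure_itv/=; case: ifP => _; rewrite ?ltry.
Qed.

Lemma le_occupation T T' : T <= T' ->
  (lebesgue_measure (occupation T) <= lebesgue_measure (occupation T'))%E.
Proof.
move=> TT'; apply: le_measure; rewrite ?inE; try exact: measurable_occupation.
by move=> t [/andP[t0 tT] Ut]; split => //; rewrite t0 (le_trans tT).
Qed.

Lemma occupation_periodic (P d : R) : 0 < d -> d <= P ->
  (forall t, y (t + P) = y t) -> (forall t, 0 <= t <= d -> U (y t)) ->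
  forall k : nat, ((k%:R * d)%:E <= lebesgue_measure (occupation (k%:R * P)))%E.
Proof.
move=> d0 dP yP Ud; have P0 : 0 < P by exact: lt_le_trans dP.
have ykP k t : y (t + k%:R * P) = y t.
  elim: k => [|k IH]; first by rewrite mul0r addr0.
  by rewrite -natr1 mulrDl mul1r addrA yP.
elim=> [|k IH]; first by rewrite mul0r.
(* The next period contributes at least this interval. It is open on the left because
   [occupation (k%:R * P)] may contain its endpoint, and the two sets have to be disjoint. *)
pose I := `]k%:R * P, (k%:R * P + d)%R]%classic : set R.
have mI : measurable I by exact: measurable_itv.
have dI : (d%:E <= lebesgue_measure I)%E.
  rewrite lebesgue_measure_itv/= lte_fin ltrDl d0.
  by rewrite -EFinB addrAC subrr add0r.
have sub : occupation (k%:R * P) `|` I `<=` occupation (k.+1%:R * P).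
  have kS : k.+1%:R * P = k%:R * P + P by rewrite -natr1 mulrDl mul1r.
  move=> t [[/andP[t0 tk] Ut]|].
    by split => //; rewrite t0 (le_trans tk)// kS lerDl ltW.
  rewrite /I/= in_itv/= => /andP[kt tk]; split.
    rewrite kS; apply/andP; split.
      by apply: le_trans (ltW kt); rewrite mulr_ge0// ltW.
    by apply: le_trans tk _; rewrite lerD2l.
  rewrite -[t](subrK (k%:R * P)) ykP; apply: Ud.
  by rewrite subr_ge0 ltW//= lerBlDl.
apply: (@le_trans _ _ (lebesgue_measure (occupation (k%:R * P) `|` I))); last first.
  apply: le_measure; rewrite ?inE//; last exact: measurable_occupation.
  by apply: measurableU => //; exact: measurable_occupation.
rewrite measureU//; [|exact: measurable_occupation|].
  rewrite -natr1 mulrDl mul1r EFinD; exact: leeD.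
apply/seteqP; split => // t [[/andP[_ tk] _]]; rewrite /I/= in_itv/= => /andP[kt _].
by move: (lt_le_trans kt tk); rewrite ltxx.
Qed.

Lemma time_fraction_periodic : Defs.periodic y -> U (y 0) ->
  exists2 k : R, 0 < k & \forall T \near +oo, k <= time_fraction y U T.
Proof.
move=> [P P0 yP] U0.
have [d [d0 dP Ud]] : exists d, [/\ 0 < d, d <= P & forall t, 0 <= t <= d -> U (y t)].
  have /nbhs_ballP[e e0 He] : nbhs (0 : R) (y @^-1` U).
    by apply: cy; exact: open_nbhs_nbhs.
  (* Half of [e] fits the closed interval into the open ball; the bound by [P] keeps it within one
     period. *)
  exists (Num.min P (e / 2)); split; rewrite ?lt_min ?P0 ?divr_gt0 ?ge_min ?lexx//.
  move=> t /andP[t0]; rewrite le_min => /andP[_ te]; apply: He.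
  rewrite /ball/= sub0r normrN ger0_norm//; apply: le_lt_trans te _.
  by rewrite ltr_pdivrMr// ltr_pMr// ltr1n.
(* With [k] full periods before [T], the occupation time is at least [k%:R * d]. Once [T] is at
   least [2 * P], the time [k%:R * P] exceeds [T - P], hence is at least [T / 2]; this accounts for
   the factor 2. *)
exists (d / (2 * P)); first by rewrite divr_gt0// mulr_gt0.
near=> T.
have TP : 2 * P <= T by near: T; apply: nbhs_pinfty_ge; exact: num_real.
have T0 : 0 < T by apply: lt_le_trans TP; rewrite mulr_gt0.
pose k := Num.truncn (T / P).
have TP0 : 0 <= T / P by rewrite divr_ge0// ltW.
have /andP[kl ku] := Num.Theory.truncn_itv TP0.
have kT : k%:R * P <= T by rewrite -ler_pdivlMr.
rewrite /time_fraction -/(occupation T) ler_pdivlMr//.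
have H := le_trans (occupation_periodic d0 dP yP Ud k) (le_occupation kT).
have fT : lebesgue_measure (occupation T) \is a fin_num.
  by rewrite ge0_fin_numE// occupation_fin.
move: H; rewrite -(fineK fT) lee_fin; apply: le_trans.
rewrite mulrAC ler_pdivrMr ?mulr_gt0//.
have : T < k.+1%:R * P by rewrite -ltr_pdivrMr.
rewrite -natr1 => Tk.
have -> : k%:R * d * (2 * P) = d * (2 * (k%:R * P)) by ring.
by rewrite ler_pM2l//; lra.
Unshelve. all: by end_near.
Qed.

End occupation.

(** * From the dichotomy to a positive occupation density *)

Theorem proposition1 (R : realType) (M : ptopologicalType) (n : nat)
    (A : smooth_manifold R M n) (g : riem_metric A)
    (vol : {measure set (g_sigma_algebraType (@open M)) -> \bar R})
    (M_compact : compact [set: M])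
    (M_connected : connected [set: M])
    (vol_g : is_riem_volume g vol)
    (M_dichotomy : dichotomy g vol) :
  forall y : R -> M, geodesic g y ->
    forall eps : R, 0 < eps -> GRC g eps y.
Proof.
move=> y gy eps eps0.
have r0 : 0 < eps / 2 by rewrite divr_gt0.
exists (y 0), (eps / 2); split => //.
  by rewrite ltr_pdivrMr// ltr_pMr// ltr1n.
set U := riem_ball g (y 0) (eps / 2).
have oU : open U by exact: riem_ball_open.
have U0 : U (y 0) by exact: riem_ball_center.
have [k k0 Hk] : exists2 k : R, 0 < k &
    \forall T \near +oo, k <= time_fraction y U T.
  have [py|uy] := M_dichotomy y gy.
    exact: (time_fraction_periodic (geodesic_continuous gy) oU).
  pose l := fine (vol U) / fine (vol [set: M]).
  (* As [fine] sends [+oo] to 0, the limit [l] is positive only because both volumes are finite. *)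
  have volM : (vol [set: M] < +oo)%E by exact: (vol_finite vol_g).
  have volU : (vol U <= vol [set: M])%E.
    by apply: le_measure; rewrite ?inE//; exact: open_borel.
  have volU0 := vol_open_gt0 vol_g oU U0.
  have l0 : 0 < l.
    apply: divr_gt0; apply: fine_gt0; apply/andP; split=> //.
      exact: le_lt_trans volM.
    exact: lt_le_trans volU.
  exists (l / 2); first by rewrite divr_gt0.
  have l2 : l / 2 < l by rewrite ltr_pdivrMr// ltr_pMr// ltr1n.
  have Hl : \forall T \near +oo, l / 2 < time_fraction y U T.
    exact: (cvgr_gt _ (uy _ oU) _ l2).
  by apply: filterS Hl => T /ltW.
exact: (limf_einf_gt0 k0 Hk).
Qed.
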